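(* Let $K$ be an infinite field and $T\in K^{n\times n\times p}$ a tensor whose slices $T_1,\ldots,T_p$ span a linear space $\langle T_1,\ldots,T_p\rangle$ containing an invertible matrix. For any integer $r\geq n$, $\mathrm{rank}(T)\leq r$ if and only if there exists an invertible matrix $A\in\langle T_1,\ldots,T_p\rangle$ such that the $p$-tuple $(A^{-1}T_1,\ldots,A^{-1}T_p)$ admits a commuting extension $(Z_1,\ldots,Z_p)$ in which each $Z_i$ is a diagonalizable (over $K$) matrix of size $r$.
   Context: Tensor rank: least number of tensors $u\otimes v\otimes w$ (entries $u_iv_jw_k$) summing to $T$. Slices of $T$: $T_k=(T_{ijk})_{i,j}$. A tuple $(Z_1,\ldots,Z_p)$ of $r\times r$ matrices is a commuting extension of a tuple $(A_1,\ldots,A_p)$ of $n\times n$ matrices ($r\ge n$) if the $Z_i$ pairwise commute and each $Z_i$ has the block form $\begin{pmatrix}A_i&B_i\\C_i&D_i\end{pmatrix}$ with $A_i$ its top-left $n\times n$ block. *)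

(* Defs.v *)
From HB Require Import structures.
From mathcomp Require Import all_boot all_order all_algebra.
From mathcomp Require Import boolp classical_sets cardinality.

Set Implicit Arguments.
Unset Strict Implicit.
Unset Printing Implicit Defensive.

Import GRing.Theory.
Local Open Scope ring_scope.

Notation tensor K m n p := {ffun 'I_m * 'I_n * 'I_p -> K}.

Definition rank_one_tensor (K : fieldType) (m n p : nat)
    (u : 'rV[K]_m) (v : 'rV[K]_n) (w : 'rV[K]_p) : tensor K m n p :=
  [ffun x => u 0 x.1.1 * v 0 x.1.2 * w 0 x.2].

Definition sum_of_rank_one (K : fieldType) (m n p : nat) (T : tensor K m n p)
    (s : nat) : Prop :=
  exists (u : 'I_s -> 'rV[K]_m) (v : 'I_s -> 'rV[K]_n) (w : 'I_s -> 'rV[K]_p),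
    T = \sum_(l < s) rank_one_tensor (u l) (v l) (w l).

Lemma ex_sum_of_rank_one (K : fieldType) (m n p : nat) (T : tensor K m n p) :
  exists s, `[< sum_of_rank_one T s >].
Proof.
pose I : finType := ('I_m * 'I_n * 'I_p)%type.
exists #|I|; apply/asboolP.
exists (fun l => T (enum_val l : I) *: delta_mx 0 (enum_val l : I).1.1),
  (fun l => delta_mx 0 (enum_val l : I).1.2),
  (fun l => delta_mx 0 (enum_val l : I).2).
apply/ffunP => -[[i j] k]; rewrite sum_ffunE.
rewrite (bigD1 (enum_rank ((i, j, k) : I))) //= big1 => [|l ne_l].
  by rewrite addr0 ffunE enum_rankK !mxE !eqxx !mulr1.
rewrite ffunE !mxE /= [i == _]eq_sym [j == _]eq_sym [k == _]eq_sym.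
have: enum_val l != (i, j, k) :> I.
  by apply: contra ne_l => /eqP <-; rewrite enum_valK.
case: (enum_val l) => [[a b] c] /=; rewrite !xpair_eqE.
by do 3![case: eqP => _ /=]; rewrite ?(mulr0, mul0r).
Qed.

Definition tensor_rank (K : fieldType) (m n p : nat) (T : tensor K m n p) :
  nat := ex_minn (ex_sum_of_rank_one T).

Definition slice (K : fieldType) (m n p : nat) (T : tensor K m n p)
    (k : 'I_p) : 'M[K]_(m, n) :=
  \matrix_(i, j) T (i, j, k).

Definition slice_span (K : fieldType) (m n p : nat) (T : tensor K m n p) :
    {vspace 'M[K]_(m, n)} :=
  <<[seq slice T k | k : 'I_p]>>%VS.

Definition commuting_extension (K : fieldType) (n r p : nat) (le_nr : (n <= r)%N)
    (A : 'I_p -> 'M[K]_n) (Z : 'I_p -> 'M[K]_r) : Prop :=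
  (forall k l, comm_mx (Z k) (Z l)) /\
  (forall k, mxsub (widen_ord le_nr) (widen_ord le_nr) (Z k) = A k).

(* Main.v *)
(** A decomposition of [T] into [r] rank-one tensors is a simultaneous
    factorization [T_k = U *m D_k *m V] with diagonal [D_k] of size [r].  For a
    generic combination [c] of the slices, [A = U *m D *m V] is invertible and
    the entry [D l l] vanishes only if [D_k l l = 0] for all [k].  Then
    [P = A^-1 *m U *m D] and [Q = V] satisfy [P *m Q = 1], so [P] is the top of
    an invertible [M] such that [Q] is the left part of [M^-1], and
    [Z_k = M *m (D^-1 *m D_k) *m M^-1].  Conversely, commuting diagonalizable
    [Z_k] are simultaneously diagonalizable, and restricting
    [Z_k = P^-1 *m D_k *m P] to its top-left block gives back [U] and [V]. *)
Require Import Defs.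
From mathcomp Require Import all_boot all_order all_algebra.
From mathcomp Require Import boolp classical_sets functions cardinality.

Import GRing.Theory.
Local Open Scope ring_scope.

Lemma infinite_field_nonroot {K : fieldType} {q : {poly K}} :
  infinite_set [set: K]%classic -> q != 0 -> exists t, q.[t] != 0.
Proof.
move=> /infiniteP /card_leP [f] q_neq0; apply/not_existsP => q_root.
pose g i := val (f (to_setT i)).
have g_inj : injective g.
  move=> i j /val_inj /(@inj _ _ _ f) fij.
  by have /(congr1 val) := fij (in_setT _) (in_setT _).
have : (size [seq g i | i <- iota 0 (size q)] < size q)%N.
  apply: max_poly_roots; rewrite ?(map_inj_uniq g_inj) ?iota_uniq //.
  by apply/allP => t _; apply/negPn/negP/q_root.
by rewrite size_map size_iota ltnn.
Qed.

(** Polynomiality is asked for only along affine lines: this suffices to move from one good point to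
    another and needs just univariate polynomials. *)
Definition poly_on_lines {K : fieldType} {E : lmodType K} (f : E -> K) : Prop :=
  forall c e, exists q : {poly K}, forall t, f (c + t *: e) = q.[t].

Lemma poly_on_lines_det {K : fieldType} {E : lmodType K} {n : nat}
    (G : {linear E -> 'M[K]_n}) : poly_on_lines (fun c => \det (G c)).
Proof.
move=> c e; exists (\det (map_mx polyC (G c) + 'X *: map_mx polyC (G e))) => t.
rewrite -horner_evalE -det_map_mx; congr (\det _).
apply/matrixP => i j; rewrite linearD linearZ !mxE /= horner_evalE.
by rewrite hornerD hornerM hornerX !hornerC.
Qed.

Lemma poly_on_lines_scalar {K : fieldType} {E : lmodType K} (g : E -> K) :
  scalar g -> poly_on_lines g.
Proof.
move=> g_scalar c e; exists ((g c)%:P + g e *: 'X) => t.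
by rewrite addrC g_scalar hornerD hornerC hornerZ hornerX addrC mulrC.
Qed.

(** Stands in for the density of nonempty Zariski-open sets over an infinite field: separate
    witnesses of nonvanishing are merged into a common one. *)
Lemma generic_nonzero {K : fieldType} {E : lmodType K} {I : eqType} {s : seq I}
    {f : I -> E -> K} :
    infinite_set [set: K]%classic ->
    {in s, forall i, poly_on_lines (f i) /\ exists c, f i c != 0} ->
  exists c, {in s, forall i, f i c != 0}.
Proof.
move=> infK; elim: s => [|i s IHs] f_gen; first by exists 0.
have [|c c_s] := IHs; first by move=> j js; apply: f_gen; rewrite inE js orbT.
have [fi_poly [e fie]] := f_gen i (mem_head _ _).
(* On the line through [c] and [e] every [f j] is a polynomial that is nonzero
   at one of these two points. *)
have f_line j : exists q : {poly K},
    j \in i :: s -> forall t, f j (c + t *: (e - c)) = q.[t].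
  have [/f_gen [/(_ c (e - c)) [q fq] _]|_] := boolP (j \in i :: s).
    by exists q.
  by exists 0.
have [q fq] := choice f_line.
(* A nonroot of the product is a nonroot of every factor. *)
have q_neq0 : \prod_(j <- i :: s) q j != 0.
  rewrite prodf_seq_neq0; apply/allP => j j_s /=; apply/negP => /eqP qj0.
  have := j_s; rewrite inE => /orP [/eqP ji|js].
    have := fq j j_s 1; rewrite qj0 horner0 scale1r addrC subrK ji => fi0.
    by rewrite fi0 eqxx in fie.
  have := fq j j_s 0; rewrite qj0 horner0 scale0r addr0 => fj0.
  by have := c_s j js; rewrite fj0 eqxx.
have [t] := infinite_field_nonroot infK q_neq0.
rewrite horner_prod prodf_seq_neq0 => /allP qt.
by exists (c + t *: (e - c)) => j j_s; rewrite fq //; apply: qt.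
Qed.

Lemma row_free_ker {K : fieldType} {k m n : nat} {Q : 'M[K]_(k, n)} :
  (k - \rank Q = m)%N -> exists2 R : 'M[K]_(m, k), row_free R & R *m Q = 0.
Proof.
rewrite -mxrank_ker => <-.
exists (row_base (kermx Q)); first exact: row_base_free.
by apply/sub_kermxP; rewrite eq_row_base.
Qed.

(** Stack [P] over a basis [R] of the left kernel of [Q]. If a row vector kills the stack,
    multiplying by [Q] shows that its [P]-part is zero, and freeness of [R] does the rest. The stack
    times [Q] is [col_mx 1%:M 0], which places [Q] in the inverse. *)
Lemma unitmx_completion {K : fieldType} {n r : nat} (le_nr : (n <= r)%N)
    {P : 'M[K]_(n, r)} {Q : 'M[K]_(r, n)} :
    P *m Q = 1%:M ->
  exists M : 'M[K]_r, [/\ M \in unitmx, rowsub (widen_ord le_nr) M = P &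
    colsub (widen_ord le_nr) (invmx M) = Q].
Proof.
have [m r_eq] : exists m, r = (n + m)%N by exists (r - n)%N; rewrite subnKC.
subst r; move=> PQ1.
have widenE i : widen_ord le_nr i = lshift m i by apply: val_inj.
have [R R_free RQ0] : exists2 R : 'M[K]_(m, n + m), row_free R & R *m Q = 0.
  apply: row_free_ker; suff -> : \rank Q = n by rewrite addKn.
  apply/eqP; rewrite eqn_leq rank_leq_col -{1}(mxrank1 K n) -PQ1.
  exact: mxrankM_maxr.
have M_unit : col_mx P R \in unitmx.
  rewrite -row_free_unit -kermx_eq0; apply/rowV0P => x /sub_kermxP.
  rewrite -[x]hsubmxK mul_row_col => xM0.
  have x0 : lsubmx x = 0.
    have /(congr1 (mulmx^~ Q)) := xM0.
    by rewrite mulmxDl -!mulmxA PQ1 RQ0 mulmx1 mulmx0 addr0 mul0mx.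
  move: xM0; rewrite x0 mul0mx add0r => /eqP.
  by rewrite mulmx_free_eq0 // => /eqP ->; rewrite row_mx0.
exists (col_mx P R); split=> //.
  by apply/matrixP => i j; rewrite mxE widenE col_mxEu.
have -> : Q = invmx (col_mx P R) *m col_mx 1%:M 0.
  by rewrite -PQ1 -RQ0 -mul_col_mx mulKmx.
rewrite -[X in colsub _ X]mulmx1 -mulmx_colsub; congr (_ *m _).
apply/matrixP => i j; rewrite mxE widenE scalar_mx_block block_mxEh.
by rewrite row_mxEl.
Qed.

(** Rank-one term [l] is made of column [l] of [U], row [l] of [V] and column [l] of [W]. *)
Lemma sum_of_rank_one_diag {K : fieldType} {m n p : nat} (T : tensor K m n p)
    (r : nat) :
  sum_of_rank_one T r <->
  exists (U : 'M[K]_(m, r)) (W : 'M[K]_(p, r)) (V : 'M[K]_(r, n)),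
    forall k, slice T k = U *m diag_mx (row k W) *m V.
Proof.
split=> [[u [v [w ->]]]|[U [W [V TE]]]].
  exists (\matrix_(i, l) u l 0 i), (\matrix_(k, l) w l 0 k),
    (\matrix_(l, j) v l 0 j) => k.
  apply/matrixP => i j; rewrite mul_mx_diag !mxE sum_ffunE.
  by apply: eq_bigr => l _; rewrite ffunE !mxE mulrAC.
exists (fun l => (col l U)^T), (fun l => row l V), (fun l => (col l W)^T).
apply/ffunP => -[[i j] k]; rewrite sum_ffunE.
have -> : T (i, j, k) = slice T k i j by rewrite mxE.
rewrite TE mul_mx_diag mxE.
by apply: eq_bigr => l _; rewrite ffunE !mxE mulrAC.
Qed.

(** Pad with zero terms. *)
Lemma sum_of_rank_one_widen {K : fieldType} {m n p : nat} (T : tensor K m n p)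
    (s r : nat) :
  (s <= r)%N -> sum_of_rank_one T s -> sum_of_rank_one T r.
Proof.
move=> le_sr; have [d ->] : exists d, r = (s + d)%N.
  by exists (r - s)%N; rewrite subnKC.
rewrite !sum_of_rank_one_diag => -[U [W [V TE]]].
exists (row_mx U 0), (row_mx W 0), (col_mx V 0) => k.
rewrite TE row_row_mx diag_mx_row mul_row_block !mul0mx !mulmx0.
by rewrite mul_row_col mulmx0 !addr0.
Qed.

Lemma tensor_rank_leP {K : fieldType} {m n p : nat} (T : tensor K m n p)
    (r : nat) :
  (tensor_rank T <= r)%N <-> sum_of_rank_one T r.
Proof.
rewrite /tensor_rank; case: ex_minnP => s /asboolP Ts s_min; split=> [|Tr].
  by move=> /sum_of_rank_one_widen; apply.
exact/s_min/asboolP.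
Qed.

Lemma slice_spanP {K : fieldType} {m n p : nat} (T : tensor K m n p)
    (A : 'M[K]_(m, n)) :
  A \in slice_span T <-> exists c : 'rV[K]_p, A = \sum_k c 0 k *: slice T k.
Proof.
rewrite /slice_span span_def big_image; split=> [/memv_sumP [a a_in ->]|[c ->]].
  have {}a_in k : exists x, a k = x *: slice T k by apply/vlineP/a_in.
  have [c aE] := fin_all_exists a_in.
  by exists (\row_k c k); apply: eq_bigr => k _; rewrite aE mxE.
by apply: memv_sumr => k _; rewrite memvZ // memv_line.
Qed.

Lemma linear_comb_diag {K : fieldType} {m n p r : nat} (c : 'rV[K]_p)
    (U : 'M[K]_(m, r)) (W : 'M[K]_(p, r)) (V : 'M[K]_(r, n)) :
  \sum_k c 0 k *: (U *m diag_mx (row k W) *m V) = U *m diag_mx (c *m W) *m V.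
Proof.
rewrite mulmx_sum_row linear_sum mulmx_sumr mulmx_suml.
by apply: eq_bigr => k _; rewrite linearZ /= -scalemxAr -scalemxAl.
Qed.

Theorem theorem3p4 (K : fieldType) (n p : nat) (T : tensor K n n p)
    (infK : infinite_set [set: K]%classic)
    (invT : exists A : 'M[K]_n, A \in slice_span T /\ A \in unitmx)
    (r : nat) (le_nr : (n <= r)%N) :
  (tensor_rank T <= r)%N <->
  exists A : 'M[K]_n, [/\ A \in slice_span T, A \in unitmx &
    exists Z : 'I_p -> 'M[K]_r,
      commuting_extension le_nr (fun k => invmx A *m slice T k) Z /\
      (forall k, diagonalizable (Z k))].
Proof.
rewrite tensor_rank_leP sum_of_rank_one_diag.
split=> [[U [W [V TE]]]|[A [A_span A_unit [Z [[Z_comm Z_ext] Z_diag]]]]].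
- have [c [detc wc]] : exists c : 'rV[K]_p,
      \det (U *m diag_mx (c *m W) *m V) != 0 /\
      forall k l, (c *m W) 0 l = 0 -> W k l = 0.
    pose detUV c := \det (U *m diag_mx (c *m W) *m V).
    (* [None] stands for the determinant and [Some l] for diagonal entry [l]. Zero columns of [W]
       are filtered out of [s], since their entry vanishes for every [c]. *)
    pose f (i : option 'I_r) c := if i is Some l then (c *m W) 0 l else detUV c.
    pose s := [seq i <- enum {: option 'I_r}
      | if i is Some l then col l W != 0 else true].
    have f_gen : {in s, forall i, poly_on_lines (f i) /\ exists c, f i c != 0}.
      move=> [l|]; rewrite mem_filter => /andP [].
        move=> /cV0Pn [k]; rewrite mxE => Wkl _; split.
          apply: poly_on_lines_scalar => a x y /=.
          by rewrite mulmxDl -scalemxAl !mxE.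
        by exists (delta_mx 0 k); rewrite /= -rowE mxE.
      move=> _ _; split.
        exact: (poly_on_lines_det
          (mulmxr V \o (mulmx U \o (diag_mx \o mulmxr W)))).
      have [B [/slice_spanP [c ->] B_unit]] := invT; exists c.
      move: B_unit; rewrite unitmxE unitfE /= /detUV -linear_comb_diag.
      by congr (\det _ != 0); apply: eq_bigr => k _; rewrite TE.
    have [c fc] := generic_nonzero infK f_gen; exists c; split.
      by apply: (fc None); rewrite mem_filter mem_enum.
    move=> k l cWl; apply/eqP; apply: contraT => Wkl.
    have : f (Some l) c != 0.
      apply: fc; rewrite mem_filter mem_enum andbT.
      by apply: contra Wkl => /eqP /colP /(_ k); rewrite !mxE => ->.
    by rewrite /= cWl eqxx.
  set A := U *m diag_mx (c *m W) *m V in detc.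
  have A_unit : A \in unitmx by rewrite unitmxE unitfE.
  exists A; split=> //.
    by apply/slice_spanP; exists c; rewrite /A -linear_comb_diag;
      apply: eq_bigr => k _; rewrite TE.
  have PQ1 : (invmx A *m U *m diag_mx (c *m W)) *m V = 1%:M.
    by rewrite -!mulmxA [U *m _]mulmxA mulVmx.
  have [M [M_unit MP MQ]] := unitmx_completion le_nr PQ1.
  (* Where the denominator vanishes so does [W k l], and [x / 0 = 0]. *)
  pose D k := \row_l (W k l / (c *m W) 0 l).
  exists (fun k => M *m diag_mx (D k) *m invmx M); split; last first.
    move=> k; exists (invmx M); first by rewrite unitmx_inv.
    apply/similar_diagLR; first by rewrite unitmx_inv.
    by exists (D k); rewrite conjVmx ?unitmx_inv // invmxK.
  split=> [k l|k].
    rewrite /comm_mx !mulmxA !(mulmxKV M_unit).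
    by rewrite -![M *m _ *m diag_mx _]mulmxA diag_mxC.
  (* The block is [invmx A *m U *m diag_mx (c *m W) *m diag_mx (D k) *m V], so it remains to cancel
     the two diagonals entrywise. *)
  rewrite mxsub_mul MQ -mul_rowsub_mx MP TE -!mulmxA; congr (_ *m (_ *m _)).
  rewrite !mulmxA mulmx_diag; congr (diag_mx _ *m _); apply/rowP => l.
  rewrite /D; move: (c *m W) (wc k l) => d d0; rewrite !mxE.
  have [/[dup] /d0 -> ->|dl_neq0] := eqVneq (d 0 l) 0; first by rewrite mul0r.
  by rewrite mulrC divfK.
- have Z_codiag : codiagonalizable [seq Z k | k : 'I_p].
    apply/codiagonalizableP; split=> [_ _ /mapP [k _ ->] /mapP [l _ ->]|].
      exact: Z_comm.
    by move=> _ /mapP [k _ ->].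
  have [P P_unit /allP P_diag] := Z_codiag.
  have {}P_diag k : exists d, Z k = invmx P *m diag_mx d *m P.
    have Zk_diag : similar_diag P (Z k).
      by apply: P_diag; rewrite map_f ?mem_enum.
    have [d ->] := elimT (similar_diagLR P_unit) Zk_diag.
    by exists d; rewrite conjVmx.
  have [d ZE] := fin_all_exists P_diag.
  (* The factor [A] undoes the normalization by [invmx A]; row [k] of the middle matrix holds the
     eigenvalues of [Z k]. *)
  exists (A *m rowsub (widen_ord le_nr) (invmx P)), (\matrix_k d k),
    (colsub (widen_ord le_nr) P) => k.
  rewrite rowK -!mulmxA -[slice T k](mulKVmx A_unit) -Z_ext ZE -mulmxA.
  by rewrite mxsub_mul -[in LHS]mulmx_colsub.
Qed.
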